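(* Let $\mathbb{K}\in\{\mathbb{R},\mathbb{C}\}$, let $V$ be a finite-dimensional $\mathbb{K}$-vector space with a fundamental tensor $g$ of arbitrary signature and an orthonormal basis $\mathcal{B}=\{n_1,\dots,n_d\}$ with respect to $g$. Let $r,l$ be integers with $2\le 2l\le r$, let $b_0\in\mathcal{B}^{r-2l}$ (with $b_0=\emptyset$ if $r=2l$), let $e\in\mathbb{K}[\mathcal{S}_r]$ be an idempotent, $\mathfrak{l}:=\mathbb{K}[\mathcal{S}_r]\cdot e$, and let $\mathfrak{p}:\mathcal{B}^r\to\mathcal{S}_r$ be a map as described below. Then $$\mathcal{L}_{\mathbb{K}}\Big\{\sum_{b\in\mathfrak{B}_{b_0}}\gamma_b\,T_b\ \Big|\ T\in\mathcal{T}_{\mathfrak{l}^{\ast}}\Big\}=\sum_{\lambda\in\Lambda_{b_0}}\ \sum_{\langle\lambda;w_i\rangle\in\mathcal{M}_{b_0,\lambda}} a_{\langle\lambda;w_i\rangle}\cdot 1_{\mathcal{H}_{t_\lambda}}\cdot\mathbb{K}[\mathcal{S}_r]\cdot e,$$ where $$a_{\langle\lambda;w_i\rangle}:=\sum_{\substack{b\in\mathfrak{B}_{b_0}\\ \mathfrak{p}(b)^{-1}b=\langle\lambda;w_i\rangle}}\gamma_b\,\mathfrak{p}(b)^{-1}.$$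
   Context: $\mathcal{T}_rV$ is the space of $r$-times covariant tensors (multilinear maps $V^r\to\mathbb{K}$); a fundamental tensor $g$ is a nondegenerate symmetric bilinear form, and $\mathcal{B}$ orthonormal means $g(n_i,n_j)=0$ ($i\ne j$), $g(n_i,n_i)\in\{\pm1\}$. $\mathcal{S}_r$ has product $(p\circ q)(i)=p(q(i))$; $\mathbb{K}[\mathcal{S}_r]$ is its group ring; $a=\sum_p a(p)p$ acts by $(aT)(v_1,\dots,v_r)=\sum_p a(p)T(v_{p(1)},\dots,v_{p(r)})$; $a^\ast:=\sum_pa(p)p^{-1}$; $\mathfrak{l}^\ast=e^\ast\mathbb{K}[\mathcal{S}_r]$ and $\mathcal{T}_{\mathfrak{l}^\ast}:=\{aT\mid a\in\mathfrak{l}^\ast, T\in\mathcal{T}_rV\}$. For $b=(v_1,\dots,v_r)\in V^r$, $T_b:=\sum_pT(v_{p(1)},\dots,v_{p(r)})\,p$, and for $q\in\mathcal{S}_r$, $qb:=(v_{q(1)},\dots,v_{q(r)})$. $\mathcal{L}_{\mathbb{K}}$ is linear span. For $b_0=(v_{2l+1},\dots,v_r)$, $\mathfrak{B}_{b_0}:=\{(w_1,w_1,\dots,w_l,w_l,v_{2l+1},\dots,v_r)\mid(w_1,\dots,w_l)\in\mathcal{B}^l\}$ (for $r=2l$, tuples $(w_1,w_1,\dots,w_l,w_l)$), with $\gamma_b:=\prod_{i=1}^lg(w_i,w_i)$. Groupings: for a partition $\lambda=(\lambda_1,\dots,\lambda_k)\vdash r$ and $(w_1,\dots,w_k)\in V^k$,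 $\langle\lambda;w_1,\dots,w_k\rangle$ is the $r$-tuple consisting of $\lambda_1$ copies of $w_1$, then $\lambda_2$ copies of $w_2$, etc. Every $b\in V^r$ can be written as $b=q\langle\lambda;w_1,\dots,w_{|\lambda|}\rangle$ with $q\in\mathcal{S}_r$, a unique partition $\lambda=:b^{\vdash}$ (the grouping partition) and $w_1,\dots,w_{|\lambda|}$ the pairwise different vectors of $b$ suitably numbered; $\langle\lambda;w_i\rangle$ is called a grouping of $b$. Order: $(n_{i_1},\dots,n_{i_s})$ is smaller than $(n_{j_1},\dots,n_{j_s})$ if the first nonzero difference $j_k-i_k$ is positive; a grouping $\langle\lambda;w_i\rangle$ of $b\in\mathcal{B}^r$ is smaller than another $\langle\lambda;w'_i\rangle$ if $(w_1,\dots,w_{|\lambda|})$ is smaller than $(w'_1,\dots,w'_{|\lambda|})$. $\mathfrak{p}:\mathcal{B}^r\to\mathcal{S}_r$ is any single-valued map assigning to each $b$ a permutation $p_b=\mathfrak{p}(b)$ with $b=p_b\langle\lambda;w_i\rangle$, where $\langle\lambda;w_i\rangle$ is the smallest grouping of $b$. $\Lambda_{b_0}:=\{\lambda\vdash r\mid\exists b\in\mathfrak{B}_{b_0}: \lambda=b^{\vdash}\}$. For $\lambda\in\Lambda_{b_0}$, $t_\lambda$ is the lexicographically smallest standard tableau of $\lambda$ (its $i$-th row contains $\lambda_1+\dots+\lambda_{i-1}+1,\dots,\lambda_1+\dots+\lambda_i$), $\mathcal{H}_{t_\lambda}$ its group of horizontal permutations (permutations mapping each row set to itself), $1_{\mathcal{H}_{t_\lambda}}:=\sum_{h\in\mathcal{H}_{t_\lambda}}h$,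 and $\mathcal{M}_{b_0,\lambda}:=\{\mathfrak{p}(b)^{-1}b\mid b\in\mathfrak{B}_{b_0},\ b^{\vdash}=\lambda\}$. *)

(* Defs.v *)
From HB Require Import structures.
From mathcomp Require Import all_boot all_order all_fingroup all_algebra.
From mathcomp Require Import all_classical all_reals.
From mathcomp Require Import complex.

Set Implicit Arguments.
Unset Strict Implicit.
Unset Printing Implicit Defensive.

Import Order.TTheory GRing.Theory.
Local Open Scope ring_scope.

(* The composition (p \o q) i = p (q i); the product of 'S_r in MathComp
   composes in the opposite order. *)
Definition pcomp (r : nat) (p q : 'S_r) : 'S_r := (q * p)%g.

Lemma pcompE r (p q : 'S_r) i : pcomp p q i = p (q i).
Proof. by rewrite /pcomp permM. Qed.

(* The group ring K[S_r]; an alias, because {ffun 'S_r -> K} itself already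
   carries the pointwise product. *)
Definition permring (K : fieldType) (r : nat) : Type := {ffun 'S_r -> K^o}.

HB.instance Definition _ (K : fieldType) (r : nat) :=
  GRing.Lmodule.copy (permring K r) {ffun 'S_r -> K^o}.

Definition perm_elt (K : fieldType) (r : nat) (p : 'S_r) : permring K r :=
  [ffun q => (q == p)%:R].
Arguments perm_elt K [r] p.

Section PermRing.
Variables (K : fieldType) (r : nat).
Implicit Types (a b c : permring K r) (p q s : 'S_r).

Definition permring_mul a b : permring K r :=
  [ffun s => \sum_p a p * b (pcomp p^-1%g s)].

Let mulE a b s : permring_mul a b s = \sum_p a p * b (s * p^-1)%g.
Proof. by rewrite ffunE. Qed.

Fact permring_mulA : associative permring_mul.
Proof.
move=> a b c; apply/ffunP => s; rewrite !mulE.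
under eq_bigr do rewrite mulE mulr_sumr.
under [RHS]eq_bigr do rewrite mulE mulr_suml.
rewrite [RHS]exchange_big; apply: eq_bigr => p _ /=.
rewrite [RHS](reindex_inj (mulIg p)); apply: eq_bigr => q _.
by rewrite mulgK invMg !mulgA mulrA.
Qed.

Fact permring_mul1 : left_id (perm_elt K 1%g) permring_mul.
Proof.
move=> a; apply/ffunP => s; rewrite mulE (bigD1 1%g) //= big1 => [|p p1].
  by rewrite ffunE eqxx mul1r invg1 mulg1 addr0.
by rewrite ffunE (negPf p1) mul0r.
Qed.

Fact permring_1mul : right_id (perm_elt K 1%g) permring_mul.
Proof.
move=> a; apply/ffunP => s; rewrite mulE (bigD1 s) //= big1 => [|p ps].
  by rewrite ffunE mulgV eqxx mulr1 addr0.
by rewrite ffunE -eq_mulgV1 eq_sym (negPf ps) mulr0.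
Qed.

Fact permring_mulDl : left_distributive permring_mul +%R.
Proof.
move=> a b c; apply/ffunP => s; rewrite !(mulE, ffunE) -big_split /=.
by apply: eq_bigr => p _; rewrite ffunE mulrDl.
Qed.

Fact permring_mulDr : right_distributive permring_mul +%R.
Proof.
move=> a b c; apply/ffunP => s; rewrite !(mulE, ffunE) -big_split /=.
by apply: eq_bigr => p _; rewrite ffunE mulrDr.
Qed.

Fact permring_1neq0 : perm_elt K (1%g : 'S_r) != 0 :> permring K r.
Proof.
by apply/eqP => /ffunP/(_ 1%g)/eqP; rewrite !ffunE eqxx oner_eq0.
Qed.

HB.instance Definition _ := GRing.Zmodule_isNzRing.Build (permring K r)
  permring_mulA permring_mul1 permring_1mul permring_mulDl permring_mulDr
  permring_1neq0.

Fact permring_scaleAl (k : K) a b : k *: (a * b) = (k *: a) * b.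
Proof.
apply/ffunP => s; rewrite ffunE !mulE /GRing.scale /= mulr_sumr.
by apply: eq_bigr => p _; rewrite ffunE -mulrA.
Qed.

HB.instance Definition _ :=
  GRing.Lmodule_isLalgebra.Build K (permring K r) permring_scaleAl.

Fact permring_scaleAr (k : K) a b : k *: (a * b) = a * (k *: b).
Proof.
apply/ffunP => s; rewrite ffunE !mulE /GRing.scale /= mulr_sumr.
by apply: eq_bigr => p _; rewrite ffunE mulrCA.
Qed.

HB.instance Definition _ :=
  GRing.Lalgebra_isAlgebra.Build K (permring K r) permring_scaleAr.

Lemma perm_eltM p q : perm_elt K p * perm_elt K q = perm_elt K (pcomp p q).
Proof.
apply/ffunP => s; rewrite mulE (bigD1 p) //= big1 => [|u up].
  by rewrite !ffunE eqxx mul1r addr0 /pcomp (can2_eq (mulgKV p) (mulgK p)).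
by rewrite ffunE (negPf up) mul0r.
Qed.

Lemma perm_elt_sum a : a = \sum_p a p *: perm_elt K p.
Proof.
apply/ffunP => s; rewrite sum_ffunE (bigD1 s) //= big1 => [|p ps].
  by rewrite !ffunE eqxx /GRing.scale /= mulr1 addr0.
by rewrite !ffunE eq_sym (negPf ps) /GRing.scale /= mulr0.
Qed.

Definition star a : permring K r := \sum_p a p *: perm_elt K p^-1%g.

End PermRing.

(* q b = (v_(q 1), ..., v_(q r)); note that p (q b) = (q \o p) b. *)
Definition permt (T : Type) (r : nat) (q : 'S_r) (b : r.-tuple T) :
  r.-tuple T := [tuple tnth b (q i) | i < r].

Section Groupings.
Variables (T : eqType) (r : nat).
Implicit Types (lam : seq nat) (w : seq T) (b : r.-tuple T).

Definition is_partition lam : bool :=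
  [&& sorted geq lam, 0%N \notin lam & sumn lam == r].

Definition group_seq lam w : seq T :=
  flatten [seq nseq x.1 x.2 | x <- zip lam w].

Definition is_grouping lam w b : Prop :=
  [/\ is_partition lam, size w = size lam, uniq w
    & exists q : 'S_r, exists2 c : r.-tuple T,
        tval c = group_seq lam w & b = permt q c].

Definition grouping_partition b : seq nat :=
  sort geq [seq count_mem x b | x <- undup b].

Let geq_total : total geq. Proof. by move=> m n; exact: leq_total. Qed.
Let geq_trans : transitive geq.
Proof. by move=> m n p /= mn pm; exact: leq_trans pm mn. Qed.
Let geq_anti : antisymmetric geq.
Proof. by move=> m n /=; rewrite andbC => /anti_leq. Qed.

Lemma is_grouping_partition lam w b :
  is_grouping lam w b -> lam = grouping_partition b.
Proof.
case=> /and3P[slam lam0 _] swl uw [q [c cE bE]].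
have pb : perm_eq b (group_seq lam w).
  rewrite -cE; apply/tuple_permP; exists q.
  by rewrite bE.
have mem_g x : (x \in group_seq lam w) = (x \in w).
  elim: lam w lam0 swl {slam uw cE pb} => [|m lam IH] [|y w] //=.
  rewrite !inE negb_or => /andP[m0 lam0] [swl].
  by rewrite /group_seq /= mem_cat -/(group_seq lam w) IH // mem_nseq lt0n
             eq_sym m0.
have cnt : [seq count_mem x (group_seq lam w) | x <- w] = lam.
  elim: lam w uw swl {slam lam0 cE pb mem_g} => [|m lam IH] [|y w] //=.
  move=> /andP[yw uw] [swl].
  rewrite /group_seq /= -/(group_seq lam w) !count_cat count_nseq /= eqxx mul1n.
  have -> : count_mem y (group_seq lam w) = 0%N.
    apply/count_memPn; apply: contra yw.
    elim: lam w {IH uw swl} => [|k lam IH] [|z w] //=.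
    rewrite /group_seq /= mem_cat -/(group_seq lam w) inE mem_nseq.
    by case/orP => [/andP[_ ->] //|/IH ->]; rewrite orbT.
  rewrite addn0; congr cons; rewrite -[RHS](IH w) //.
  apply/eq_in_map => x xw; rewrite count_cat count_nseq /=.
  case: eqP => [yx|_]; last by rewrite mul0n.
  by rewrite yx xw in yw.
apply: (sorted_eq geq_trans geq_anti slam (sort_sorted geq_total _)).
rewrite perm_sym perm_sort -[X in perm_eq _ X]cnt.
rewrite (eq_map (g := fun x => count_mem x (group_seq lam w))); last first.
  by move=> x; exact: (elimT seq.permP pb).
apply/perm_map/uniq_perm; rewrite ?undup_uniq // => x.
by rewrite mem_undup (perm_mem pb) mem_g.
Qed.

Lemma grouping_exists b : exists w, is_grouping (grouping_partition b) w b.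
Proof.
pose f x := count_mem x b.
exists (sort (relpre f geq) (undup b)).
have gE : grouping_partition b = [seq f x | x <- sort (relpre f geq) (undup b)].
  by rewrite -sort_map.
have pg : perm_eq (group_seq (grouping_partition b)
                     (sort (relpre f geq) (undup b))) b.
  rewrite gE /group_seq; set w := sort _ _.
  have -> : zip [seq f x | x <- w] w = [seq (f x, x) | x <- w].
    by elim: w => //= x w ->.
  rewrite -map_comp; apply: perm_trans (perm_count_undup b).
  by apply/perm_flatten/perm_map; rewrite perm_sort.
split.
- apply/and3P; split; first exact: sort_sorted.
    rewrite mem_sort; apply/mapP => -[x]; rewrite mem_undup => xb /esym/eqP.
    by rewrite -leqn0 leqNgt -has_count has_pred1 xb.
  move: (perm_size pg); rewrite size_tuple => /eqP; congr (_ == _).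
  rewrite gE /group_seq size_flatten /shape -map_comp; set w := sort _ _.
  by congr sumn; elim: w => //= x w ->; rewrite size_nseq.
- by rewrite gE size_map.
- by rewrite sort_uniq undup_uniq.
- have sz : size (group_seq (grouping_partition b)
                   (sort (relpre f geq) (undup b))) == r.
    by rewrite (perm_size pg) size_tuple.
  have [q qE] : exists q : 'S_r, tval b = [tuple tnth (Tuple sz) (q i) | i < r].
    by apply/tuple_permP; rewrite perm_sym.
  by exists q, (Tuple sz) => //; apply: val_inj.
Qed.

End Groupings.

(* A tuple of elements of the basis (n_1, ..., n_d) is represented by the tuple
   of its indices. *)
Definition basis_tuple (K : fieldType) (V : vectType K) (d : nat)
    (n : d.-tuple V) (r : nat) (b : r.-tuple 'I_d) : r.-tuple V :=
  map_tuple (tnth n) b.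

Section SmallestGroupings.
Variables (d r : nat).
Implicit Types (w : seq 'I_d) (b : r.-tuple 'I_d).

Definition smaller w w' : Prop :=
  let i := [seq val x | x <- w] in let j := [seq val x | x <- w'] in
  exists2 k : nat, (forall m, (m < k)%N -> nth 0%N i m = nth 0%N j m)
                 & (nth 0%N i k < nth 0%N j k)%N.

Definition is_smallest_grouping w b : Prop :=
  is_grouping (grouping_partition b) w b /\
  (forall w', is_grouping (grouping_partition b) w' b ->
     w' = w \/ smaller w w').

Definition grouping_perm_map (p : r.-tuple 'I_d -> 'S_r) : Prop :=
  forall b, exists w, exists2 c : r.-tuple 'I_d,
    is_smallest_grouping w b /\ tval c = group_seq (grouping_partition b) w
    & b = permt (p b) c.

End SmallestGroupings.

Section Contractions.
Variables (d r l : nat) (b0 : (r - 2 * l).-tuple 'I_d).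

Definition pairings : {set r.-tuple 'I_d} :=
  [set b : r.-tuple 'I_d | [exists w : l.-tuple 'I_d,
     tval b == flatten [seq [:: x; x] | x <- w] ++ b0]]%SET.

Definition pairing_partitions : seq (seq nat) :=
  undup [seq grouping_partition b | b <- enum pairings].

Definition pairing_groupings (p : r.-tuple 'I_d -> 'S_r) (lam : seq nat) :
  {set r.-tuple 'I_d} :=
  [set permt (p b)^-1%g b | b in pairings & grouping_partition b == lam]%SET.

End Contractions.

(* gamma_b for b = (w_1, w_1, ..., w_l, w_l, ...): w_i is the entry of b at
   the (0-based) position 2 * i. *)
Definition gamma (K : fieldType) (V : vectType K) (g : V -> V -> K) (l : nat)
    (b : seq V) : K :=
  \prod_(i < l) g b`_(2 * i) b`_(2 * i).

Definition grouping_coef (K : fieldType) (V : vectType K) (g : V -> V -> K)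
    (d : nat) (n : d.-tuple V) (r l : nat) (b0 : (r - 2 * l).-tuple 'I_d)
    (p : r.-tuple 'I_d -> 'S_r) (c : r.-tuple 'I_d) : permring K r :=
  \sum_(b in pairings b0 | permt (p b)^-1%g b == c)
     gamma g l (basis_tuple n b) *: perm_elt K (p b)^-1%g.

(* The rows of the lexicographically smallest standard tableau, with entries
   0, ..., r - 1. *)
Definition smallest_tableau (r : nat) (lam : seq nat) : seq (seq 'I_r) :=
  reshape lam (enum 'I_r).

Definition horizontal_perms (r : nat) (t : seq (seq 'I_r)) : {set 'S_r} :=
  [set h : 'S_r | all (fun row : seq 'I_r =>
     [set h i | i in row] == [set i in row]) t]%SET.

Definition perm_set_sum (K : fieldType) (r : nat) (H : {set 'S_r}) :
  permring K r := \sum_(h in H) perm_elt K h.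
Arguments perm_set_sum K [r] H.

Section Tensors.
Variables (K : fieldType) (V : vectType K) (r : nat).
Implicit Types (T : r.-tuple V -> K).

Definition set_slot (v : r.-tuple V) (i : 'I_r) (x : V) : r.-tuple V :=
  [tuple if j == i then x else tnth v j | j < r].

Definition multilinear T : Prop :=
  forall (v : r.-tuple V) (i : 'I_r), scalar (fun x => T (set_slot v i x)).

Definition tensor_act (a : permring K r) T : r.-tuple V -> K :=
  fun v => \sum_p a p * T (permt p v).

Definition tensor_elt T (b : r.-tuple V) : permring K r :=
  [ffun p => T (permt p b)].

Local Open Scope classical_set_scope.

Definition tensor_class (I : set (permring K r)) : set (r.-tuple V -> K) :=
  [set tensor_act a T | a in I & T in multilinear].

End Tensors.

Section SetSums.
Local Open Scope classical_set_scope.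

Definition linear_span (K : fieldType) (U : lmodType K) (X : set U) : set U :=
  [set y | exists m (k : 'I_m -> K) (x : 'I_m -> U),
     (forall i, X (x i)) /\ y = \sum_(i < m) k i *: x i].

Definition add_sets (U : zmodType) (A B : set U) : set U :=
  [set x + y | x in A & y in B].

End SetSums.

Definition orthonormal_basis (K : fieldType) (V : vectType K)
    (g : V -> V -> K) (d : nat) (n : d.-tuple V) : Prop :=
  [/\ basis_of fullv n,
      forall i j : 'I_d, i != j -> g (tnth n i) (tnth n j) = 0
    & forall i : 'I_d, g (tnth n i) (tnth n i) = 1 \/
                       g (tnth n i) (tnth n i) = -1].

(* Main.v *)
(** Since [T_(q b) = q^-1 T_b], grouping the pairings [b] by
    [c = p(b)^-1 b] turns [sum_b gamma_b T_b] into [sum_c a_c T_c]. The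
    stabiliser of [c] is the group [H] of horizontal permutations, so
    [T_c = 1_H T_c / |H|], and acting on [T] by [e^* x] multiplies [T_c] by
    [x^* e] on the right; this gives one inclusion. For the other one, smallest
    groupings represent the [S_r]-orbits of basis tuples uniquely, so for every
    [x] there is a tensor [T] with [T_c = 1_H x] that vanishes on all
    permutations of the other groupings. *)

Require Import Defs.
From HB Require Import structures.
From mathcomp Require Import all_boot all_order all_fingroup all_algebra.
From mathcomp Require Import all_classical all_reals.
From mathcomp Require Import complex.

Set Implicit Arguments.
Unset Strict Implicit.
Unset Printing Implicit Defensive.

Import Order.TTheory GRing.Theory.
Local Open Scope ring_scope.
Local Open Scope classical_set_scope.

(** * The action of permutations on tuples *)

Section PermutedTuples.
Variables (T : Type) (r : nat).
Implicit Types (p q : 'S_r) (b : r.-tuple T).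

(** Entry [i] on the left is entry [q (p i)] of [b], and the product [p * q] applies [p] first; so
    [permt] is a left action for this product. *)
Lemma permtM p q b : permt p (permt q b) = permt (p * q)%g b.
Proof. by apply: eq_from_tnth => i; rewrite !tnth_mktuple permM. Qed.

Lemma permt1 b : permt 1%g b = b.
Proof. by apply: eq_from_tnth => i; rewrite tnth_mktuple perm1. Qed.

Lemma permtK p b : permt p^-1%g (permt p b) = b.
Proof. by rewrite permtM mulVg permt1. Qed.

Lemma permtKV p b : permt p (permt p^-1%g b) = b.
Proof. by rewrite permtM mulgV permt1. Qed.

End PermutedTuples.

Lemma basis_tuple_permt (K : fieldType) (V : vectType K) d (n : d.-tuple V) r
    (q : 'S_r) (b : r.-tuple 'I_d) :
  basis_tuple n (permt q b) = permt q (basis_tuple n b).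
Proof.
by apply: eq_from_tnth => i; rewrite tnth_map !tnth_mktuple tnth_map.
Qed.

(** * Convolution and the anti-involution [star] *)

Section GroupRing.
Variables (K : fieldType) (r : nat).
Implicit Types (a b : permring K r) (p s : 'S_r).

Lemma permring_mulE a b s : (a * b) s = \sum_p a p * b (s * p^-1)%g.
Proof. by rewrite ffunE. Qed.

Lemma perm_elt_mulE p a s : (perm_elt K p * a) s = a (s * p^-1)%g.
Proof.
rewrite permring_mulE (bigD1 p) //= big1 => [|q qp].
  by rewrite ffunE eqxx mul1r addr0.
by rewrite ffunE (negPf qp) mul0r.
Qed.

Lemma perm_set_sum_mulE (H : {set 'S_r}) a s :
  (perm_set_sum K H * a) s = \sum_(h in H) a (s * h^-1)%g.
Proof.
by rewrite mulr_suml sum_ffunE; apply: eq_bigr => h _; rewrite perm_elt_mulE.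
Qed.

Lemma starE a s : star a s = a s^-1%g.
Proof.
rewrite sum_ffunE (bigD1 s^-1%g) //= big1 => [|p ps].
  by rewrite !ffunE invgK eqxx addr0 [LHS]mulr1.
rewrite !ffunE -(inj_eq invg_inj) invgK eq_sym (negPf ps).
by rewrite [LHS]mulr0.
Qed.

Lemma starK a : star (star a) = a.
Proof. by apply/ffunP => s; rewrite !starE invgK. Qed.

Lemma starM a b : star (a * b) = star b * star a.
Proof.
apply/ffunP => s; rewrite starE !permring_mulE.
rewrite [RHS](reindex_inj (mulIg s)) /=; apply: eq_bigr => p _.
by rewrite mulrC !starE (invMg p) mulKVg invgK.
Qed.

End GroupRing.

(** * Dependence of [T_v] on the tensor and on the tuple *)

Section TensorElements.
Variables (K : fieldType) (V : vectType K) (r : nat).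
Implicit Types (T : r.-tuple V -> K) (v : r.-tuple V) (a : permring K r).

Lemma tensor_elt_permt T q v :
  tensor_elt T (permt q v) = perm_elt K q^-1%g * tensor_elt T v.
Proof.
by apply/ffunP => s; rewrite perm_elt_mulE !ffunE permtM invgK.
Qed.

(** The coefficient at [s] is the sum of [a p * T_v (p * s)]. Here [p] is the quotient of [p * s] by
    [s], the inverse of what a convolution needs, hence [star]. *)
Lemma tensor_elt_act T a v :
  tensor_elt (tensor_act a T) v = tensor_elt T v * star a.
Proof.
apply/ffunP => s; rewrite ffunE permring_mulE /tensor_act.
rewrite [RHS](reindex_inj (mulIg s)) /=; apply: eq_bigr => p _.
by rewrite ffunE starE permtM (invMg p) mulKVg invgK mulrC.
Qed.

Lemma perm_set_sum_stab T v (H : {set 'S_r}) :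
    (forall h, h \in H -> permt h v = v) ->
  perm_set_sum K H * tensor_elt T v = #|H|%:R *: tensor_elt T v.
Proof.
move=> Hv; rewrite mulr_suml scaler_nat -sumr_const; apply: eq_bigr => h hH.
by rewrite -{1}(invgK h) -tensor_elt_permt -{1}(Hv h hH) permtK.
Qed.

End TensorElements.

(** * Tensors with prescribed values on basis tuples *)

Section TensorsFromBasis.
Variables (K : fieldType) (V : vectType K) (d r : nat) (n : d.-tuple V).

(** A combination of tensor products of coordinate forms; over a basis [n], the tensor with
    components [f]. *)
Definition tensor_of_coords (f : r.-tuple 'I_d -> K) (v : r.-tuple V) : K :=
  \sum_b f b * \prod_(i < r) coord n (tnth b i) (tnth v i).

Lemma tensor_of_coords_multilinear f : multilinear (tensor_of_coords f).
Proof.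
move=> v i k x y; rewrite /tensor_of_coords mulr_sumr -big_split /=.
apply: eq_bigr => b _; rewrite mulrCA -mulrDr; congr (_ * _).
rewrite !(bigD1 i (P := predT)) //= !tnth_mktuple eqxx linearP.
rewrite mulrDl mulrA.
by congr (_ * _ + _ * _); apply: eq_bigr => j ji;
  rewrite !tnth_mktuple (negPf ji).
Qed.

Lemma tensor_of_coordsE f b :
  free n -> tensor_of_coords f (basis_tuple n b) = f b.
Proof.
move=> fn; rewrite /tensor_of_coords (bigD1 b) //=.
rewrite [X in _ + X]big1 => [|b' b'b].
  rewrite big1 ?mulr1 ?addr0 // => i _.
  by rewrite tnth_map (tnth_nth 0) coord_free // eqxx.
have [i bi] : exists i, tnth b' i != tnth b i.
  apply/existsP; rewrite -negb_forall; apply: contra b'b => /forallP h.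
  by apply/eqP/eq_from_tnth => i; apply/eqP.
rewrite (bigD1 i) //= tnth_map (tnth_nth 0) coord_free //.
by rewrite eq_sym (negPf bi) mul0r mulr0.
Qed.

End TensorsFromBasis.

Lemma eq_imset_r (aT rT : finType) (f : aT -> rT) (A B : {pred aT}) :
  A =i B -> (f @: A = f @: B)%SET.
Proof.
by move=> AB; apply/setP => y; apply/imsetP/imsetP => -[x xA ->]; exists x;
  rewrite // -?AB // AB.
Qed.

(** * Horizontal permutations as stabilisers of groupings *)

Section GroupingStabilisers.
Variables (T : eqType).

Lemma mem_group_seq lam (w : seq T) x : x \in group_seq lam w -> x \in w.
Proof.
elim: lam w => [|m lam IH] [|y w] //=.
rewrite /group_seq /= mem_cat inE mem_nseq -/(group_seq lam w).
by case/orP=> [/andP[_ ->]//|/IH->]; rewrite orbT.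
Qed.

(** Rows and blocks of equal values are cut at the same places, so [f] is constant on each row. As
    [w] has no repetitions, distinct rows carry distinct values, and each row is a full fibre of
    [f]. *)
Lemma reshape_group_seq (I : finType) (f : I -> T) lam (w : seq T) (s : seq I) :
    size w = size lam -> uniq w -> map f s = group_seq lam w ->
  [seq [set i in row]%SET | row : seq I <- reshape lam s] =
  [seq [set i in s | f i == x]%SET | x <- w].
Proof.
elim: lam w s => [|m lam IH] [|y w] s //= [swl] /andP[yw uw].
rewrite /group_seq /= -/(group_seq lam w) => fs.
have ft : map f (take m s) = nseq m y.
  by rewrite map_take fs take_size_cat // size_nseq.
have fd : map f (drop m s) = group_seq lam w.
  by rewrite map_drop fs drop_size_cat // size_nseq.
have takey i : i \in take m s -> f i = y.
  by move=> /(map_f f); rewrite ft mem_nseq => /andP[_ /eqP].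
have dropw i : i \in drop m s -> f i \in w.
  by move=> /(map_f f); rewrite fd => /mem_group_seq.
have mems i : (i \in s) = (i \in take m s) || (i \in drop m s).
  by rewrite -mem_cat cat_take_drop.
congr cons.
  apply/setP => i; rewrite !inE mems.
  case: (boolP (i \in take m s)) => [/takey ->|_] /=.
    by rewrite eqxx.
  by apply/esym/negP => /andP[/dropw fw /eqP fy]; rewrite fy (negPf yw) in fw.
rewrite (IH w) //; apply/eq_in_map => x xw; apply/setP => i; rewrite !inE mems.
case: eqP => [fx|_]; last by rewrite !andbF.
rewrite !andbT; case: (boolP (i \in take m s)) => //= /takey fy.
by rewrite -fy fx xw in yw.
Qed.

(** The rows of the tableau are the fibres of [c], and preserving every fibre amounts to leaving [c]
    unchanged. *)
Lemma horizontal_permsP r lam (w : seq T) (c : r.-tuple T) (h : 'S_r) :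
    size w = size lam -> uniq w -> tval c = group_seq lam w ->
  (h \in horizontal_perms (smallest_tableau r lam)) = (permt h c == c).
Proof.
move=> swl uw cE.
pose A x := [set i | tnth c i == x]%SET.
have rows : [seq [set i in row]%SET | row : seq 'I_r <- smallest_tableau r lam]
            =             [seq A x | x <- w].
  rewrite (reshape_group_seq (f := tnth c) (w := w)) //; last first.
    by rewrite -cE -[RHS]map_tnth_enum.
  by apply: eq_map => x; apply/setP => i; rewrite !inE mem_enum.
transitivity (all (fun B : {set 'I_r} => h @: B == B)%SET (map A w)).
  rewrite -rows all_map inE; apply: eq_all => row /=; congr (_ == _).
  by apply: eq_imset_r => i; rewrite inE.
rewrite all_map; apply/allP/eqP => [hA|hc x _ /=].
  apply: eq_from_tnth => i; rewrite tnth_mktuple.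
  have xw : tnth c i \in w.
    by apply: (@mem_group_seq lam); rewrite -cE mem_tnth.
  have /eqP := hA _ xw => /setP/(_ (h i)).
  by rewrite imset_f ?inE // => /esym/eqP.
(* By injectivity of [h], mapping a fibre into itself suffices. *)
rewrite eqEcard card_imset ?leqnn ?andbT //; last exact: perm_inj.
apply/fintype.subsetP => _ /imsetP[i + ->]; rewrite !inE.
by rewrite -{1}hc tnth_mktuple.
Qed.

End GroupingStabilisers.

(** * Smallest groupings as orbit representatives *)

Section SmallestGroupingUnique.
Variables (d r : nat).
Implicit Types (w : seq 'I_d) (b : r.-tuple 'I_d).

Lemma smaller_asym w w' : smaller w w' -> smaller w' w -> False.
Proof.
move=> [k hk ltk] [k' hk' ltk'].
case: (ltngtP k k') => kk'.
- by rewrite (hk' _ kk') ltnn in ltk.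
- by rewrite (hk _ kk') ltnn in ltk'.
- by rewrite kk' in ltk; have := ltn_trans ltk ltk'; rewrite ltnn.
Qed.

Lemma smallest_grouping_unique w w' b :
  is_smallest_grouping w b -> is_smallest_grouping w' b -> w = w'.
Proof.
move=> [gw sw] [gw' sw']; case: (sw _ gw') => // ww'.
case: (sw' _ gw) => // w'w.
by case: (smaller_asym ww' w'w).
Qed.

(** Any grouping of [b] also groups its permutations, and a grouping determines the partition. *)
Lemma grouping_partition_permt (T : eqType) (q : 'S_r) (b : r.-tuple T) :
  grouping_partition (permt q b) = grouping_partition b.
Proof.
have [w [pw sw uw [s [c cE bE]]]] := grouping_exists b.
apply/esym/(@is_grouping_partition _ _ _ w); split=> //.
by exists (q * s)%g, c; rewrite // bE permtM.
Qed.

Lemma is_grouping_permt lam w (q : 'S_r) b :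
  is_grouping lam w b -> is_grouping lam w (permt q b).
Proof.
move=> [pw sw uw [s [c cE bE]]]; split=> //.
by exists (q * s)%g, c; rewrite // bE permtM.
Qed.

Lemma is_smallest_grouping_permt w (q : 'S_r) b :
  is_smallest_grouping w b -> is_smallest_grouping w (permt q b).
Proof.
move=> [gw sw]; split; rewrite grouping_partition_permt.
  exact: is_grouping_permt.
by move=> w' /(is_grouping_permt q^-1%g); rewrite permtK => /sw.
Qed.

Variable p : r.-tuple 'I_d -> 'S_r.
Hypothesis hp : grouping_perm_map p.

Lemma grouping_permP b : exists2 w, is_smallest_grouping w b &
  tval (permt (p b)^-1%g b) = group_seq (grouping_partition b) w.
Proof.
by have [w [c [sw cE] bE]] := hp b; exists w => //; rewrite {2}bE permtK.
Qed.

(** Both sides spell out the smallest grouping, which is unique and common to the whole orbit. *)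
Lemma grouping_perm_orbit b q :
  permt (p (permt q b))^-1%g (permt q b) = permt (p b)^-1%g b.
Proof.
have [w /(is_smallest_grouping_permt q) sw wE] := grouping_permP b.
have [w' sw' w'E] := grouping_permP (permt q b).
apply: val_inj => /=; rewrite w'E wE grouping_partition_permt.
by rewrite (smallest_grouping_unique sw sw').
Qed.

Lemma horizontal_perms_stab b h : let c := permt (p b)^-1%g b in
  (h \in horizontal_perms (smallest_tableau r (grouping_partition b))) =
  (permt h c == c).
Proof.
have [w [[_ sw uw _] _] wE] := grouping_permP b.
exact: horizontal_permsP wE.
Qed.

End SmallestGroupingUnique.

(** * Sums of sets and linear spans *)

Section SetSums.

Lemma big_add_sets_sub (U : zmodType) (I : Type) (s : seq I) (P : pred I)
    (A : I -> set U) (S : set U) :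
    S 0 -> (forall x y, S x -> S y -> S (x + y)) ->
    (forall i, P i -> A i `<=` S) ->
  \big[@add_sets U/[set 0]]_(i <- s | P i) A i `<=` S.
Proof.
move=> S0 SD AS; elim/big_rec: _ => [_ ->//|i B Pi BS _ [x Ax [y By <-]]].
by apply: SD; [exact: AS Ax|exact: BS].
Qed.

Lemma big_add_setsI (U : zmodType) (I : eqType) (s : seq I) (P : pred I)
    (A : I -> set U) (f : I -> U) :
    (forall i, i \in s -> P i -> A i (f i)) ->
  (\big[@add_sets U/[set 0]]_(i <- s | P i) A i) (\sum_(i <- s | P i) f i).
Proof.
elim: s => [|i s IH] fA; first by rewrite !big_nil.
have {}IH : (\big[@add_sets U/[set 0]]_(i <- s | P i) A i)
              (\sum_(i <- s | P i) f i).
  by apply: IH => j js; apply: fA; rewrite inE js orbT.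
rewrite !big_cons; case: ifP => // Pi.
exists (f i); first by apply: fA; rewrite ?mem_head.
by exists (\sum_(i <- s | P i) f i).
Qed.

Lemma linear_span0 (K : fieldType) (U : lmodType K) (X : set U) :
  linear_span X 0.
Proof.
by exists 0%N, (fun=> 0), (fun=> 0); split=> [[]//|]; rewrite big_ord0.
Qed.

Lemma linear_spanD (K : fieldType) (U : lmodType K) (X : set U) x y :
  linear_span X x -> linear_span X y -> linear_span X (x + y).
Proof.
move=> [m [k [u [Xu ->]]]] [m' [k' [u' [Xu' ->]]]].
exists (m + m')%N,
  (fun i => match fintype.split i with inl j => k j | inr j => k' j end),
  (fun i => match fintype.split i with inl j => u j | inr j => u' j end).
split=> [i|]; first by case: fintype.split.
rewrite big_split_ord /=; congr (_ + _); apply: eq_bigr => i _.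
  by rewrite (unsplitK (inl i)).
by rewrite (unsplitK (inr i)).
Qed.

Lemma sub_linear_span (K : fieldType) (U : lmodType K) (X : set U) :
  X `<=` linear_span X.
Proof.
move=> x Xx; exists 1%N, (fun=> 1), (fun=> x).
by split=> //; rewrite big_ord1 scale1r.
Qed.

End SetSums.

(** * Sorting the pairings by their groupings *)

Section Contraction.
Variables (K : fieldType) (V : vectType K) (g : V -> V -> K).
Variables (d : nat) (n : d.-tuple V) (r l : nat) (b0 : (r - 2 * l).-tuple 'I_d).
Variable p : r.-tuple 'I_d -> 'S_r.

Definition contraction_elt (T : r.-tuple V -> K) : permring K r :=
  \sum_(b in pairings b0)
    gamma g l (basis_tuple n b) *: tensor_elt T (basis_tuple n b).

Lemma contraction_elt_act a T :
  contraction_elt (tensor_act a T) = contraction_elt T * star a.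
Proof.
rewrite mulr_suml; apply: eq_bigr => b _.
by rewrite tensor_elt_act scalerAl.
Qed.

(** If [c = p(b)^-1 b], then [p(b)^-1 T_c = T_(p(b) c) = T_b], term by term. *)
Lemma grouping_coef_tensor T c :
  grouping_coef g n b0 p c * tensor_elt T (basis_tuple n c) =
  \sum_(b in pairings b0 | permt (p b)^-1%g b == c)
    gamma g l (basis_tuple n b) *: tensor_elt T (basis_tuple n b).
Proof.
rewrite mulr_suml; apply: eq_bigr => b /andP[_ /eqP bc].
by rewrite -scalerAl -tensor_elt_permt -basis_tuple_permt -bc permtKV.
Qed.

Lemma contraction_elt_groupings T : contraction_elt T =
  \sum_(lam <- pairing_partitions b0) \sum_(c in pairing_groupings b0 p lam)
    grouping_coef g n b0 p c * tensor_elt T (basis_tuple n c).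
Proof.
transitivity (\sum_(lam <- pairing_partitions b0)
  \sum_(b in pairings b0 | grouping_partition b == lam)
    gamma g l (basis_tuple n b) *: tensor_elt T (basis_tuple n b)).
  rewrite (exchange_big_dep (mem (pairings b0))) /=; last first.
    by move=> ? ? _ /andP[].
  (* The list of partitions has no duplicates, so each [b] is counted exactly once. *)
  apply: eq_bigr => b bP; rewrite -big_filter.
  have -> : [seq lam <- pairing_partitions b0 | (b \in pairings b0) &&
              (grouping_partition b == lam)] = [:: grouping_partition b].
    rewrite bP /= (eq_filter (a2 := pred1 (grouping_partition b))); last first.
      by move=> lam; rewrite /= eq_sym.
    rewrite filter_pred1_uniq ?undup_uniq // mem_undup.
    by apply: map_f; rewrite mem_enum.
  by rewrite big_seq1.
apply: eq_bigr => lam _.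
rewrite (partition_big_imset (fun b => permt (p b)^-1%g b)) /=.
apply: eq_big => [c|c /imsetP[b' /andP[_ /eqP b'lam] cE]].
  by congr (c \in pred_of_set _); apply: eq_imset_r => b; rewrite [RHS]inE.
(* The sum in [grouping_coef] does not fix the partition of [b]; it is forced, because [b] is a
   permutation of [c]. *)
rewrite grouping_coef_tensor; apply: eq_bigl => b.
case: (permt _ _ =P c) => [bc|_]; last by rewrite !andbF.
rewrite !andbT [LHS]unfold_in -(grouping_partition_permt (p b)^-1%g b) bc cE.
by rewrite grouping_partition_permt b'lam eqxx andbT.
Qed.

End Contraction.

(** Characteristic zero, for dividing by the order of a group of horizontal permutations. *)
Lemma natr_neq0_RC (R : realType) (K : fieldType) m :
  K = R :> fieldType \/ K = R[i]%C :> fieldType -> (0 < m)%N -> m%:R != 0 :> K.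
Proof.
by case: m => // m [] -> _; rewrite Num.Theory.pnatr_eq0.
Qed.

(** * The two inclusions between the span and the sum of the sets [a_c 1_H K[S_r] e] *)

Theorem theorem7p4 (R : realType) (K : fieldType)
    (hK : K = R :> fieldType \/ K = R[i]%C :> fieldType)
    (V : vectType K) (g : {symmetric V}) (hg : nondegenerate g)
    (d : nat) (n : d.-tuple V) (hn : orthonormal_basis g n)
    (r l : nat) (hl : (2 <= 2 * l)%N) (hr : (2 * l <= r)%N)
    (b0 : (r - 2 * l).-tuple 'I_d)
    (e : permring K r) (he : e * e = e)
    (p : r.-tuple 'I_d -> 'S_r) (hp : grouping_perm_map p) :
  linear_span
    [set \sum_(b in pairings b0)
           gamma g l (basis_tuple n b) *: tensor_elt T (basis_tuple n b)
     | T in tensor_class [set star e * x | x in [set: permring K r]]]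
  = \big[@add_sets (permring K r)/[set 0]]_(lam <- pairing_partitions b0)
      \big[@add_sets (permring K r)/[set 0]]_(c in pairing_groupings b0 p lam)
        [set grouping_coef g n b0 p c
               * perm_set_sum K (horizontal_perms (smallest_tableau r lam))
               * x * e
        | x in [set: permring K r]].
Proof.
apply/seteqP; split=> [_ [m [k [x [Xx ->]]]]|].
  have /choice[y Hy] i : exists yT : permring K r * (r.-tuple V -> K),
      x i = contraction_elt g n b0 yT.2 * yT.1 * e.
    have [_ [_ [y _ <-] [T _ <-]] <-] := Xx i.
    (* The acting element is [star e * y], and its [star] is [star y * e]. *)
    exists (star y, T).
    by rewrite -/(contraction_elt _ _ _ _) contraction_elt_act starM starK
               mulrA.
  pose H lam := horizontal_perms (smallest_tableau r lam).
  (* One ring element per [lam] and [c] collects all [m] generators; the division cancels the factor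
     in [1_H T_c = |H| T_c]. *)
  pose z lam c := \sum_(i < m)
    (k i / #|H lam|%:R) *: (tensor_elt (y i).2 (basis_tuple n c) * (y i).1).
  have -> : \sum_(i < m) k i *: x i =
      \sum_(lam <- pairing_partitions b0)
      \sum_(c in pairing_groupings b0 p lam)
        grouping_coef g n b0 p c * perm_set_sum K (H lam) * z lam c * e.
    rewrite (eq_bigr (fun i => \sum_(lam <- pairing_partitions b0)
      \sum_(c in pairing_groupings b0 p lam) k i *: (grouping_coef g n b0 p c *
        tensor_elt (y i).2 (basis_tuple n c) * (y i).1 * e))); last first.
      move=> i _; rewrite Hy (contraction_elt_groupings _ _ _ p).
      rewrite !mulr_suml scaler_sumr; apply: eq_bigr => lam _.
      by rewrite !mulr_suml scaler_sumr.
    rewrite exchange_big; apply: eq_bigr => lam _.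
    rewrite exchange_big; apply: eq_bigr => c /imsetP[b].
    rewrite inE => /andP[_ /eqP blam] cE.
    rewrite mulr_sumr mulr_suml; apply: eq_bigr => i _.
    have stab h : h \in H lam -> permt h (basis_tuple n c) = basis_tuple n c.
      rewrite /H -blam (horizontal_perms_stab hp) -cE => /eqP hc.
      by rewrite -basis_tuple_permt hc.
    rewrite -scalerAr -scalerAl -!mulrA [perm_set_sum _ _ * _]mulrA.
    rewrite (perm_set_sum_stab _ stab) -scalerAl -scalerAr scalerA.
    rewrite mulfVK // (natr_neq0_RC hK) //.
    apply/card_gt0P; exists 1%g.
    by rewrite /H -blam (horizontal_perms_stab hp) permt1.
  apply: big_add_setsI => lam _ _.
  by apply: big_add_setsI => c _ _; exists (z lam c).
(* Conversely, the span is closed under addition, so a single summand [a_c 1_H x e] is enough. *)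
apply: big_add_sets_sub => [||lam _].
- exact: linear_span0.
- exact: linear_spanD.
apply: big_add_sets_sub => [||c].
- exact: linear_span0.
- exact: linear_spanD.
case/imsetP => b; rewrite [_ \in _]inE => /andP[bP /eqP blam] cE _ [x _ <-].
have fn : free n by case: hn => /basis_free.
(* Summing over all [q] with [q c = b'] makes the coordinates well defined:
   the values of [x] are added up over a coset of the stabiliser of [c]. *)
pose T := tensor_of_coords n (fun b' => \sum_(q | permt q c == b') x q).
have Tc : tensor_elt T (basis_tuple n c) =
    perm_set_sum K (horizontal_perms (smallest_tableau r lam)) * x.
  apply/ffunP => s; rewrite perm_set_sum_mulE ffunE -basis_tuple_permt /T.
  (* With [q = s * h^-1], the condition [q c = s c] says that [h] fixes [c], that is, [h] is
     horizontal. *)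
  rewrite tensor_of_coordsE // (reindex_inj (mulgI s)) /=.
  rewrite (reindex_inj invg_inj) /=.
  apply: eq_bigl => h.
  rewrite -permtM -blam (horizontal_perms_stab hp) -cE.
  rewrite (can_eq (@permtK _ _ s)).
  apply/eqP/eqP => [/(congr1 (permt h))|hc]; first by rewrite permtKV.
  by rewrite -{1}hc permtK.
have Tc' b' : permt (p b')^-1%g b' != c -> tensor_elt T (basis_tuple n b') = 0.
  move=> b'c; apply/ffunP => s; rewrite !ffunE -basis_tuple_permt /T.
  rewrite tensor_of_coordsE // big_pred0 // => q.
  (* If [q c = s b'], then [b'] lies in the orbit of [b], so its representative is [c]. *)
  apply: contraNF b'c => /eqP/(congr1 (permt s^-1%g)).
  by rewrite permtK cE !permtM => <-; rewrite grouping_perm_orbit.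
(* Acting by [star e] supplies the right factor [e]. *)
apply: sub_linear_span; exists (tensor_act (star e) T).
  exists (star e); first by exists 1; rewrite ?mulr1.
  by exists T => //; exact: tensor_of_coords_multilinear.
rewrite -/(contraction_elt _ _ _ _) contraction_elt_act starK; congr (_ * _).
rewrite -mulrA -Tc grouping_coef_tensor [LHS]/contraction_elt.
(* Only pairings with grouping [c] survive; they add up to [a_c T_c]. *)
rewrite (bigID (fun b' => permt (p b')^-1%g b' == c)) /=.
rewrite [X in _ + X]big1 ?addr0 //.
by move=> b' /andP[_ /Tc' ->]; rewrite scaler0.
Qed.
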